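(* Let $\widehat{\mathcal{A}}\in\mathbb{R}^{2mn\times 2mn}$ and $\mathcal{P}_S\in\mathbb{C}^{2mn\times 2mn}$ be $$\widehat{\mathcal{A}}=\begin{bmatrix}\mathcal{T} & -\alpha I_n\otimes I_m\\ \alpha I_n\otimes I_m & \mathcal{T}^{\top}\end{bmatrix},\qquad \mathcal{P}_S=\begin{bmatrix}\mathcal{S} & -\alpha I_n\otimes I_m\\ \alpha I_n\otimes I_m & \mathcal{S}^{*}\end{bmatrix},$$ where $\mathcal{T}=B_n\otimes I_m+\tau I_n\otimes(-L_m)$ and $\mathcal{S}=S_n\otimes I_m+\tau I_n\otimes(-L_m)$. Then $$\mathcal{P}_S^{-1}\widehat{\mathcal{A}}=I_{2mn}+\widetilde{\mathcal{R}}_1,$$ where $I_{2mn}$ is the $2mn\times 2mn$ identity matrix and $\operatorname{rank}(\widetilde{\mathcal{R}}_1)\le 4m$.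
   Context: Let $n\ge 2$ and $m\ge 1$ be integers, $\tau>0$, $\gamma>0$, $\alpha=\tau/\sqrt{\gamma}$, $\theta\in[\tfrac12,1]$, and $\omega=e^{\mathbf{i}\zeta}$ with $\zeta\in[0,2\pi)$. $I_k$ is the $k\times k$ identity matrix, $\otimes$ is the Kronecker product, and $^{*}$ is the conjugate transpose. $-L_m\in\mathbb{R}^{m\times m}$ is a symmetric positive semi-definite matrix (the discretization matrix of the negative Laplacian). $B_n=B_n^{(1)}(B_n^{(2)})^{-1}$, where $B_n^{(1)}$ is the $n\times n$ lower bidiagonal matrix with $1$ on the diagonal, $-1$ on the first subdiagonal and zeros elsewhere, and $B_n^{(2)}$ is the $n\times n$ lower bidiagonal matrix with $\theta$ on the diagonal, $1-\theta$ on the first subdiagonal and zeros elsewhere. $S_n=S_n^{(1)}(S_n^{(2)})^{-1}$, where $S_n^{(1)}=B_n^{(1)}-\omega\, e_1e_n^{\top}$ and $S_n^{(2)}=B_n^{(2)}+\omega(1-\theta)\,e_1e_n^{\top}$, i.e. they coincide with $B_n^{(1)}$, $B_n^{(2)}$ except for the top-right corner entry, which is $-\omega$ and $\omega(1-\theta)$ respectively (here $e_j$ is the $j$-th standard basis vector of $\mathbb{R}^n$; for $n=2$ this corner is the $(1,2)$ entry). It is assumed throughout that $S_n^{(2)}$ is nonsingular. *)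

(* Defs.v *)
From mathcomp Require Import all_boot all_order all_algebra.
From mathcomp Require Import reals trigo.
From mathcomp Require Import complex mxtens spectral sesquilinear.

Set Implicit Arguments.
Unset Strict Implicit.
Unset Printing Implicit Defensive.

Import Order.TTheory GRing.Theory Num.Theory.
Local Open Scope ring_scope.
Local Open Scope complex_scope.
Local Open Scope sesquilinear_scope.

(* The index [j] is 1-based, so that [std_vec F n 1] and [std_vec F n n] are
   the first and last vectors of the canonical basis. *)
Definition std_vec (F : pzRingType) (n j : nat) : 'cV[F]_n :=
  \col_i (i.+1 == j)%:R.

Definition lower_bidiag (F : pzRingType) (n : nat) (d s : F) : 'M[F]_n :=
  \matrix_(i, j) (if i == j then d
                  else if i == j.+1 :> nat then s else 0).

Definition pos_semidef (F : numDomainType) (m : nat) (A : 'M[F]_m) : Prop :=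
  forall x : 'cV[F]_m, 0 <= (x^T *m A *m x) 0 0.

Definition expi (R : realType) (zeta : R) : R[i] := cos zeta +i* sin zeta.

(* Entrywise embedding of real matrices into complex ones. *)
Definition to_complex (R : realType) (p q : nat) (A : 'M[R]_(p, q)) :
    'M[R[i]]_(p, q) :=
  map_mx (real_complex R) A.

Section Matrices.
Variables (R : realType) (n m : nat).
Implicit Types (theta tau alpha : R) (omega : R[i]) (L : 'M[R]_m).

Definition Bn1 : 'M[R]_n := lower_bidiag n 1 (- 1).
Definition Bn2 theta : 'M[R]_n := lower_bidiag n theta (1 - theta).
Definition Bn theta : 'M[R]_n := Bn1 *m invmx (Bn2 theta).

Definition corner : 'M[R[i]]_n := std_vec _ n 1 *m (std_vec _ n n)^T.

Definition Sn1 omega : 'M[R[i]]_n := to_complex Bn1 - omega *: corner.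
Definition Sn2 theta omega : 'M[R[i]]_n :=
  to_complex (Bn2 theta) + (omega * (1 - theta)%:C) *: corner.
Definition Sn theta omega : 'M[R[i]]_n := Sn1 omega *m invmx (Sn2 theta omega).

Definition calT theta tau L : 'M[R]_(n * m) :=
  Bn theta *t 1%:M + tau *: (1%:M *t (- L)).

Definition calS theta omega tau L : 'M[R[i]]_(n * m) :=
  Sn theta omega *t 1%:M + tau%:C *: (1%:M *t (- to_complex L)).

Definition Ahat theta tau alpha L : 'M[R]_(n * m + n * m) :=
  block_mx (calT theta tau L) (- (alpha *: (1%:M *t 1%:M)))
           (alpha *: (1%:M *t 1%:M)) (calT theta tau L)^T.

Definition PS theta omega tau alpha L : 'M[R[i]]_(n * m + n * m) :=
  block_mx (calS theta omega tau L) (- (alpha%:C *: (1%:M *t 1%:M)))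
           (alpha%:C *: (1%:M *t 1%:M)) ((calS theta omega tau L) ^t*).

End Matrices.

Arguments Sn2 {R} n theta omega.
Arguments Ahat {R} n {m} theta tau alpha L.
Arguments PS {R} n {m} theta omega tau alpha L.

(* Main.v *)
Require Import Defs.
From mathcomp Require Import all_boot all_order all_algebra.
From mathcomp Require Import reals trigo.
From mathcomp Require Import complex mxtens spectral sesquilinear.
Import Order.TTheory GRing.Theory Num.Theory.
Local Open Scope ring_scope.

(** Write P for the preconditioner and A for the complexified system matrix,
    so that P^-1 A = 1 + P^-1 (A - P), and two facts are needed: P is
    invertible, and A - P has small rank.

    Invertibility is due only to the block shape [S, -a; a, S*] with a > 0:
    a row vector (x, y) in the left kernel satisfies x S = - a y and
    y S* = a x, so the number x S y* equals - a |y|^2, while its conjugate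
    y S* x* equals a |x|^2. Hence |x|^2 + |y|^2 = 0
    ([skew_block_unitmx]).

    For the rank, the off-diagonal blocks and the Laplacian terms cancel in
    A - P, which leaves the diagonal blocks D (x) I_m and (D (x) I_m)* with
    D = B_n - S_n. Both factors of S_n differ from those of B_n by multiples
    of the same rank-one matrix e_1 e_n^T, so D is itself of the form
    (column)(row) ([rank_mul_invmx_perturb]). Ranks are multiplicative under
    Kronecker products ([rank_tensmx_le]), so each block has rank at most m;
    this gives the bound 2m, which is sharper than the stated 4m. *)

Section Field.
Context {F : fieldType}.

(** Full-rank factorizations of the factors multiply to a factorization of the
    Kronecker product through a space of dimension [\rank A * \rank B]. *)
Lemma rank_tensmx_le {m n p q} (A : 'M[F]_(m, n)) (B : 'M[F]_(p, q)) :
  (\rank (A *t B) <= \rank A * \rank B)%N.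
Proof.
rewrite -{1}[A]mulmx_base -{1}[B]mulmx_base -tensmx_mul.
exact: leq_trans (mxrankM_maxl _ _) (rank_leq_col _).
Qed.

(** Clearing the right denominator [M2' = M2 + b u v], the difference becomes
    [b M1 M2^-1 u v + a u v], a column times [v]. *)
Lemma rank_mul_invmx_perturb {n} (M1 M2 : 'M[F]_n) (u : 'cV[F]_n)
    (v : 'rV[F]_n) (a b : F) :
    M2 \in unitmx -> M2 + b *: (u *m v) \in unitmx ->
  (\rank (M1 *m invmx M2
          - (M1 - a *: (u *m v)) *m invmx (M2 + b *: (u *m v)))%R <= 1)%N.
Proof.
set M2' := M2 + _ => uM2 uM2'.
set D := (X in \rank X).
have -> : D = (b *: (M1 *m invmx M2 *m u) + a *: u) *m (v *m invmx M2').
  apply: (can_inj (mulmxK uM2')).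
  rewrite mulmxA mulmxKV // mulmxBl mulmxKV // mulmxDr mulmxKV //.
  rewrite mulmxDl -scalemxAr -!scalemxAl mulmxA.
  by rewrite opprB addrCA [M1 + _]addrC addrK addrC.
exact: leq_trans (mxrankM_maxl _ _) (rank_leq_col _).
Qed.

End Field.

Lemma tensmx11 (K : comPzRingType) (m n : nat) :
  (1%:M : 'M[K]_m) *t (1%:M : 'M[K]_n) = 1%:M.
Proof.
apply/matrixP => i j.
case: (mxtens_indexP i) => i1 i2; case: (mxtens_indexP j) => j1 j2.
rewrite tensmxE !mxE (can_eq (@mxtens_indexK m n)) xpair_eqE.
by rewrite -natrM mulnb.
Qed.

Lemma lower_bidiag_unitmx (F : fieldType) (n : nat) (d s : F) :
  d != 0 -> lower_bidiag n d s \in unitmx.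
Proof.
move=> d0; rewrite unitmxE det_trig.
  by rewrite unitfE; apply/prodf_neq0 => i _; rewrite mxE eqxx.
apply/is_trig_mxP => i j ltij; rewrite mxE ifF; last first.
  by apply/eqP => eij; rewrite eij ltnn in ltij.
by rewrite ifF //; apply/eqP => eij; move: ltij; rewrite eij ltnNge leqnSn.
Qed.

Section Skew.
Local Open Scope sesquilinear_scope.
Context {C : numClosedFieldType}.

Lemma mulmx_trmxC_ge0 {n} (x : 'rV[C]_n) : 0 <= (x *m x ^t*) 0 0.
Proof. by rewrite -dotmxE dnorm_ge0. Qed.

Lemma mulmx_trmxC_eq0 {n} (x : 'rV[C]_n) : (x *m x ^t*) 0 0 = 0 -> x = 0.
Proof. by rewrite -dotmxE => /eqP; rewrite dnorm_eq0 => /eqP. Qed.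

Lemma trmxC_mul {m n p} (A : 'M[C]_(m, n)) (B : 'M[C]_(n, p)) :
  (A *m B) ^t* = B ^t* *m A ^t*.
Proof. by rewrite trmx_mul map_mxM. Qed.

(** The number [x S y*] computed from either block equation is [- a |y|^2],
    respectively the conjugate of [a |x|^2]. *)
Lemma skew_block_unitmx {n} (S : 'M[C]_n) (a : C) : 0 < a ->
  block_mx S (- (a *: 1%:M)) (a *: 1%:M) (S ^t*) \in unitmx.
Proof.
move=> a_gt0; rewrite -row_free_unit -kermx_eq0.
apply/rowV0P => v /sub_kermxP; rewrite -[v]hsubmxK.
set x := lsubmx v; set y := rsubmx v.
rewrite mul_row_block -row_mx0 => /eq_row_mx[].
rewrite mulmxN -!scalemxAr !mulmx1 => /eqP; rewrite addr_eq0 => /eqP xS.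
rewrite addrC => /eqP; rewrite subr_eq0 => /eqP yS.
have xSy : a *: (x *m x ^t*) = - (a *: (y *m y ^t*)).
  rewrite scalemxAl -yS -{1}[y]trmxCK -trmxC_mul -trmxC_mul mulmxA xS.
  rewrite mulNmx -scalemxAl raddfN /= map_mxN linearZ /= map_mxZ /=.
  by rewrite (CrealP (gtr0_real a_gt0)) trmxC_mul trmxCK.
have : a * ((x *m x ^t*) 0 0 + (y *m y ^t*) 0 0) == 0.
  have /matrixP/(_ 0 0) := xSy.
  rewrite [LHS]mxE [RHS]mxE [X in _ = - X]mxE mulrDr => ->.
  by rewrite addNr.
rewrite mulf_eq0 gt_eqF //= paddr_eq0 ?mulmx_trmxC_ge0 //.
case/andP => /eqP/mulmx_trmxC_eq0-> /eqP/mulmx_trmxC_eq0->.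
by rewrite row_mx0.
Qed.

End Skew.

Section Perturbation.
Local Open Scope complex_scope.
Local Open Scope sesquilinear_scope.
Context {R : realType}.

Lemma trmxC_to_complex {p q} (A : 'M[R]_(p, q)) :
  (to_complex A) ^t* = to_complex A^T.
Proof. by apply/matrixP => i j; rewrite !mxE; exact: conjc_real. Qed.

Lemma rank_Bn_sub_Sn {n : nat} {theta : R} (omega : R[i]) : theta != 0 ->
    Sn2 n theta omega \in unitmx ->
  (\rank (to_complex (Bn n theta) - Sn n theta omega)%R <= 1)%N.
Proof.
move=> theta0 uS2.
rewrite /Bn /to_complex map_mxM map_invmx.
apply: rank_mul_invmx_perturb uS2.
by rewrite map_unitmx lower_bidiag_unitmx.
Qed.

Lemma calT_sub_calS {n m : nat} (theta tau : R) (omega : R[i])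
    (L : 'M[R]_m) :
  to_complex (calT n theta tau L) - calS n theta omega tau L
  = (to_complex (Bn n theta) - Sn n theta omega) *t 1%:M.
Proof.
rewrite /calT /calS /to_complex map_mxD map_mxZ !map_mxT map_mxN !map_mx1.
rewrite opprD addrACA subrr addr0.
by apply/matrixP => i j; rewrite !mxE mulrBl.
Qed.

Lemma Ahat_sub_PS {n m : nat} (theta tau alpha : R) (omega : R[i])
    (L : 'M[R]_m) :
  let E := to_complex (calT n theta tau L) - calS n theta omega tau L in
  to_complex (Ahat n theta tau alpha L) - PS n theta omega tau alpha L
  = block_mx E 0 0 (E ^t*).
Proof.
rewrite /Ahat /PS /to_complex map_block_mx opp_block_mx add_block_mx.
rewrite map_mxN map_mxZ map_mxT !map_mx1 opprK addNr subrr.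
by rewrite -!/(to_complex _) -trmxC_to_complex linearB /= map_mxB.
Qed.

End Perturbation.

Theorem proposition3p1 (R : realType) (n m : nat) (tau gamma theta zeta : R)
    (L : 'M[R]_m)
    (hn : (2 <= n)%N) (hm : (1 <= m)%N) (htau : 0 < tau) (hgamma : 0 < gamma)
    (htheta : 1 / 2 <= theta <= 1) (hzeta : 0 <= zeta < 2 * pi)
    (hLsym : (- L)^T = - L) (hLpsd : pos_semidef (- L))
    (hS2 : Sn2 n theta (expi zeta) \in unitmx) :
  let alpha := tau / Num.sqrt gamma in
  let P := PS n theta (expi zeta) tau alpha L in
  P \in unitmx /\
  exists R1 : 'M[R[i]%C]_(n * m + n * m),
    invmx P *m to_complex (Ahat n theta tau alpha L) = 1%:M + R1 /\
    (\rank R1 <= 4 * m)%N.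
Proof.
move=> alpha P.
have theta0 : theta != 0.
  by case/andP: htheta => h _; rewrite gt_eqF // (lt_le_trans _ h) // divr_gt0.
have alpha_gt0 : 0 < (real_complex R alpha).
  by rewrite ltcR divr_gt0 // sqrtr_gt0.
have uP : P \in unitmx.
  by rewrite /P /PS tensmx11; exact: skew_block_unitmx.
split => //.
set A := to_complex _.
exists (invmx P *m (A - P)); split.
  by rewrite mulmxBr mulVmx // addrC subrK.
apply: leq_trans (mxrankM_maxr _ _) _.
rewrite Ahat_sub_PS rank_diag_block_mx mxrank_map mxrank_tr calT_sub_calS.
rewrite addnn -mul2n (@leq_trans (2 * m)) // ?leq_mul2r ?orbT //.
rewrite leq_mul2l (leq_trans (rank_tensmx_le _ _)) // mxrank1.
by rewrite -[leqRHS]mul1n leq_mul2r rank_Bn_sub_Sn ?orbT.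
Qed.
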